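(* Let $\mu$ be a compactly supported probability measure on $\mathbb{R}$, different from a Dirac mass, and such that all its free cumulants $(\kappa_i(\mu);i\ge1)$ are nonnegative. Let $s_\mu$ be the maximum of the support of $\mu$. Set $$\rho=\Big(\limsup_{n\to\infty}\kappa_n(\mu)^{1/n}\Big)^{-1}\qquad\text{and}\qquad \nu=1+\lim_{t\uparrow\rho}\frac{t^2R_\mu'(t)-1}{tR_\mu(t)+1}.$$ If $\nu\ge1$, there exists a unique number $\xi$ in $(0,\rho]$ such that $R_\mu'(\xi)=1/\xi^2$, and, in addition, $$s_\mu=\begin{cases}\dfrac1\xi+R_\mu(\xi)&\text{if }\nu\ge1,\\[2mm] \dfrac1\rho+R_\mu(\rho)&\text{if }\nu<1.\end{cases}$$
   Context: For a compactly supported probability measure $\mu$ on $\mathbb{R}$, its Cauchy transform is $G_\mu(z)=\int_{\mathbb{R}}\frac{\mu(dt)}{z-t}$ for $z\in\mathbb{C}\setminus\operatorname{supp}\mu$. It is analytic and locally invertible on a neighbourhood of $\infty$; its inverse $K_\mu$ is meromorphic around $0$ with a simple pole of residue $1$ at $0$. The $R$-transform is $R_\mu(z)=K_\mu(z)-\frac1z=\sum_{n=0}^{\infty}\kappa_{n+1}(\mu)z^n$, and the coefficients $(\kappa_n(\mu);n\ge1)$ are the free cumulants of $\mu$. Here $\rho\in(0,\infty]$ is the radius of convergence of this series; for $t\in(0,\rho]$ finite, $R_\mu(t)$ and $R'_\mu(t)$ denote the sums $\sum_{n\ge0}\kappa_{n+1}(\mu)t^n$ and $\sum_{n\ge1}n\kappa_{n+1}(\mu)t^{n-1}$.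 The limit $\nu$ may be $+\infty$. *)

(* Defs.v *)
From HB Require Import structures.
From mathcomp Require Import all_boot all_order all_algebra.
From mathcomp Require Import all_classical all_reals all_analysis.
From mathcomp Require Import complex.

Set Implicit Arguments.
Unset Strict Implicit.
Unset Printing Implicit Defensive.

Import Order.TTheory GRing.Theory Num.Theory.
Import numFieldNormedType.Exports.

Local Open Scope classical_set_scope.
Local Open Scope ring_scope.
Local Open Scope complex_scope.

Section defs.
Context {R : realType}.
Implicit Types (mu : probability (measurableTypeR R) R) (kappa : nat -> R).

Definition msupport mu : set R :=
  [set x | forall U : set R, open U -> U x -> (0 < mu U)%E].

Definition is_maximum (A : set R) (s : R) : Prop := A s /\ ubound A s.

Definition is_dirac mu : Prop :=
  exists a : R, forall A : set (measurableTypeR R), measurable A ->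
    mu A = (\d_a A)%E.

(* A total function, meaningful for z outside the support of mu; the integral
   of the complex-valued integrand is taken componentwise. *)
Definition cauchy_transform mu (z : R[i]) : R[i] :=
  (\int[mu]_(t in [set: R]) complex.Re ((z - t%:C)^-1)) +i*
  (\int[mu]_(t in [set: R]) complex.Im ((z - t%:C)^-1)).

(* K is the inverse, defined on a punctured neighbourhood of 0, of the
   restriction of G to a neighbourhood of infinity. *)
Definition inverse_at_infinity (G K : R[i] -> R[i]) : Prop :=
  (exists M : R, forall w : R[i], M%:C < `|w| -> K (G w) = w) /\
  (exists2 e : R, 0 < e &
    forall z : R[i], 0 < `|z| < e%:C -> G (K z) = z).

(* The n-th free cumulant is kappa n for n >= 1; kappa 0 is irrelevant.
   R[i]^o carries the usual topology of the modulus. *)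
Definition are_free_cumulants mu kappa : Prop :=
  exists2 K : R[i] -> R[i],
    inverse_at_infinity (cauchy_transform mu) K &
    exists2 e : R, 0 < e &
      forall z : R[i], 0 < `|z| < e%:C ->
        series (fun n => (kappa n.+1)%:C * z ^+ n : R[i]^o) @ \oo
          --> (K z - z^-1 : R[i]^o).

(* The inverse is that of \bar R: 0^-1 = +oo and +oo^-1 = 0. *)
Definition conv_radius kappa : \bar R :=
  ((limn_esup (fun n => (kappa n `^ n%:R^-1)%:E))^-1)%E.

(* Sums of series with nonnegative terms (nonnegative cumulants, t >= 0), hence
   always defined in \bar R; a sum is finite iff the series converges. *)
Definition Rtrans kappa (t : R) : \bar R :=
  (\sum_(0 <= n <oo) (kappa n.+1 * t ^+ n)%:E)%E.

Definition Rtrans' kappa (t : R) : \bar R :=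
  (\sum_(1 <= n <oo) (n%:R * kappa n.+1 * t ^+ n.-1)%:E)%E.

(* Neighbourhoods of x from the left, traced on R; -oo has no real number on
   its left, so its filter is the improper one. *)
Definition ereal_at_left (x : \bar R) : set_system R :=
  match x with
  | r%:E => r^'-
  | +oo%E => pinfty_nbhs R
  | -oo%E => [set: set R]
  end.

(* For 0 <= t < conv_radius kappa both sums are finite, so fine is harmless. *)
Definition nu_quotient kappa (t : R) : R :=
  (t ^+ 2 * fine (Rtrans' kappa t) - 1) / (t * fine (Rtrans kappa t) + 1).

Definition nu kappa : \bar R :=
  (1 + lim ((nu_quotient kappa t)%:E @[t --> ereal_at_left (conv_radius kappa)]))%E.

End defs.

(* Main.v *)
Require Import Defs.
From HB Require Import structures.
From mathcomp Require Import all_boot all_order all_algebra.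
From mathcomp Require Import all_classical all_reals all_analysis.
From mathcomp Require Import complex measurable_realfun.
From mathcomp Require Import ring lra.

Set Implicit Arguments.
Unset Strict Implicit.
Unset Printing Implicit Defensive.

Import Order.TTheory GRing.Theory Num.Theory.
Import numFieldNormedType.Exports.

Local Open Scope classical_set_scope.
Local Open Scope ring_scope.

(** Let X be the translate of mu by c >= 0 with X >= 0 on the support, let M be
    the generating function of the moments of X, let s' = s + c, and put
    F(t) = 1 + c t + t R(t), so that F(t) / t = c + K(t). The definition of the
    free cumulants reads M(v) = F(v M(v)) for small v > 0. As M and F have
    nonnegative coefficients, this is an identity of formal power series, hence
    it holds in [0, +oo] as soon as M(v) is finite.

    Conversely, if v F(u) <= u for some u > 0, then the partial sums of v M(v)
    stay below u. Thus M(v) is finite iff v F(u) <= u for some u > 0; since M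
    converges on [0, 1 / s'[ and diverges beyond 1 / s', this says
    s = inf_{u > 0} (1 / u + R(u)), without any analytic continuation.

    It remains to minimize the convex function K(u) = 1 / u + R(u) on ]0, rho]:
    the infimum is attained at the zero xi of K' if there is one, and at rho
    otherwise, and nu = 1 + lim t K'(t) / K(t) tells these cases apart. *)

(** * Power series with nonnegative coefficients, with values in [0, +oo] *)

Section nonneg_power_series.
Context {R : realType}.
Implicit Types (a b f m : nat -> R) (t u v : R) (n k N : nat).

(** For nonnegative terms a divergent sum takes the value [+oo], so that convergence is expressed by
    finiteness. *)
Definition psum a t : \bar R := (\sum_(0 <= n <oo) (a n * t ^+ n)%:E)%E.

Lemma psum_term_ge0 a t n : (forall n, 0 <= a n) -> 0 <= t ->
  (0 <= (a n * t ^+ n)%:E)%E.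
Proof. by move=> a0 t0; rewrite lee_fin mulr_ge0 ?exprn_ge0. Qed.

Lemma psum_ge0 a t : (forall n, 0 <= a n) -> 0 <= t -> (0 <= psum a t)%E.
Proof. by move=> a0 t0; apply: nneseries_ge0 => n _ _; exact: psum_term_ge0. Qed.

Lemma psum_fin_num a t : (forall n, 0 <= a n) -> 0 <= t ->
  (psum a t < +oo)%E -> psum a t \is a fin_num.
Proof. by move=> a0 t0 ?; rewrite ge0_fin_numE// psum_ge0. Qed.

Lemma le_psum a b t : (forall n, 0 <= a n) -> (forall n, a n <= b n) -> 0 <= t ->
  (psum a t <= psum b t)%E.
Proof.
move=> a0 ab t0; apply: lee_nneseries => [n _ _|n _]; first exact: psum_term_ge0.
by rewrite lee_fin ler_wpM2r ?exprn_ge0.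
Qed.

Lemma psum_homo a t u : (forall n, 0 <= a n) -> 0 <= t -> t <= u ->
  (psum a t <= psum a u)%E.
Proof.
move=> a0 t0 tu; apply: lee_nneseries => [n _ _|n _]; first exact: psum_term_ge0.
by rewrite lee_fin ler_wpM2l// lerXn2r// nnegrE (le_trans t0).
Qed.

Lemma partial_le_psum a t N : (forall n, 0 <= a n) -> 0 <= t ->
  ((\sum_(0 <= n < N) a n * t ^+ n)%:E <= psum a t)%E.
Proof.
move=> a0 t0; rewrite -sumEFin; apply: nneseries_lim_ge => n _ _.
exact: psum_term_ge0.
Qed.

Lemma psum_le_partial a t (x : \bar R) : (forall n, 0 <= a n) -> 0 <= t ->
  (forall N, ((\sum_(0 <= n < N) a n * t ^+ n)%:E <= x)%E) -> (psum a t <= x)%E.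
Proof.
move=> a0 t0 H; apply: lime_le.
  by apply: is_cvg_nneseries => n _ _; exact: psum_term_ge0.
by apply: nearW => N; rewrite sumEFin.
Qed.

Definition conv a b n := \sum_(i < n.+1) a i * b (n - i)%N.

Lemma conv_ge0 a b : (forall n, 0 <= a n) -> (forall n, 0 <= b n) ->
  forall n, 0 <= conv a b n.
Proof. by move=> a0 b0 n; apply: sumr_ge0 => i _; rewrite mulr_ge0. Qed.

(** Cauchy product by Tonelli: the triangular array is extended by zero to all pairs of indices, and
    the two summations are exchanged. *)
Lemma psum_conv a b t (B : R) : (forall n, 0 <= a n) -> (forall n, 0 <= b n) ->
  0 <= t -> psum b t = B%:E -> psum (conv a b) t = (psum a t * B%:E)%E.
Proof.
move=> a0 b0 t0 tB.
pose c i n : \bar R := if (i <= n)%N then (a i * b (n - i)%N * t ^+ n)%:E else 0%E.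
have c0 i n : (0 <= c i n)%E.
  by rewrite /c; case: ifP => // _; rewrite lee_fin !mulr_ge0 ?exprn_ge0.
transitivity (\sum_(0 <= n <oo) \sum_(0 <= i <oo) c i n)%E.
  apply: eq_eseriesr => n _; rewrite (nneseries_split 0 n.+1)// add0n.
  rewrite [X in (_ + X)%E]eseries0 ?adde0; last first.
    by move=> i ni _; rewrite /c leqNgt ni.
  rewrite /conv mulr_suml -sumEFin big_mkord; apply: eq_bigr => i _.
  by rewrite /c -ltnS ltn_ord.
rewrite nneseries_interchange// muleC -nneseriesZl; last first.
  by move=> n _; exact: psum_term_ge0.
apply: eq_eseriesr => i _; rewrite (nneseries_split 0 i)// add0n big_nat.
rewrite big1 ?add0e; last by move=> n /andP[_ ni]; rewrite /c leqNgt ni.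
rewrite -nneseries_addn// muleC -tB -nneseriesZl; last first.
  by move=> n _; exact: psum_term_ge0.
apply: eq_eseriesr => n _; rewrite /c leq_addl addnK -EFinM; congr EFin.
by rewrite exprD; ring.
Qed.

Fixpoint cpow a k : nat -> R :=
  if k is k'.+1 then conv (cpow a k') a else fun n => (n == 0)%:R.

Lemma cpow_ge0 a k : (forall n, 0 <= a n) -> forall n, 0 <= cpow a k n.
Proof.
move=> a0; elim: k => [n|k IH] /=; first exact: ler0n.
exact: conv_ge0.
Qed.

Lemma psum_cpow a k t (A : R) : (forall n, 0 <= a n) -> 0 <= t ->
  psum a t = A%:E -> psum (cpow a k) t = (A ^+ k)%:E.
Proof.
move=> a0 t0 tA; elim: k => [|k IH] /=.
  rewrite /psum (nneseries_split 0 1) ?add0n; last first.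
    by move=> n _; rewrite lee_fin mulr_ge0 ?exprn_ge0.
  rewrite big_nat1 eqxx mul1r expr0 eseries0 ?adde0// => i i0 _.
  by rewrite eqn0Ngt i0 mul0r.
rewrite (psum_conv _ _ _ tA)//; last exact: cpow_ge0.
by rewrite IH -EFinM exprSr.
Qed.

(** A series without constant term has a [k]-th power of order at least [k]. *)
Lemma cpow_small a k n : a 0 = 0 -> (n < k)%N -> cpow a k n = 0.
Proof.
move=> a0; elim: k n => // k IH n nk /=; apply: big1 => i _.
have [ik|ki] := ltnP i k; first by rewrite IH ?mul0r.
have -> : (n - i = 0)%N by apply/eqP; rewrite subn_eq0 (leq_trans _ ki).
by rewrite a0 mulr0.
Qed.

Lemma eq_cpow a b k n : (forall j, (j <= n)%N -> a j = b j) ->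
  cpow a k n = cpow b k n.
Proof.
elim: k n => // k IH n ab /=; apply: eq_bigr => i _.
have iN : (i <= n)%N by rewrite -ltnS.
by rewrite IH ?ab ?leq_subr// => j ji; apply: ab; exact: leq_trans iN.
Qed.

(** Coefficients of the composite f(a(X)) when [a 0 = 0]: by [cpow_small], powers beyond [n] do not
    contribute to the coefficient of index [n]. *)
Definition pcomp f a n := \sum_(k < n.+1) f k * cpow a k n.

Lemma pcomp_ge0 f a : (forall n, 0 <= f n) -> (forall n, 0 <= a n) ->
  forall n, 0 <= pcomp f a n.
Proof.
by move=> f0 a0 n; apply: sumr_ge0 => k _; rewrite mulr_ge0// cpow_ge0.
Qed.

Lemma eq_pcomp f a b n : (forall j, (j <= n)%N -> a j = b j) ->
  pcomp f a n = pcomp f b n.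
Proof. by move=> ab; apply: eq_bigr => k _; rewrite (eq_cpow k ab). Qed.

(** Tonelli again, over the power [k] and the degree [n]; the sum of [f] at [A] may be infinite. *)
Lemma psum_pcomp f a t (A : R) : (forall n, 0 <= f n) -> (forall n, 0 <= a n) ->
  a 0 = 0 -> 0 <= t -> psum a t = A%:E -> psum (pcomp f a) t = psum f A.
Proof.
move=> f0 a0 a00 t0 tA.
pose c k n : \bar R := (f k * cpow a k n * t ^+ n)%:E.
have c0 k n : (0 <= c k n)%E.
  by rewrite lee_fin !mulr_ge0 ?exprn_ge0// cpow_ge0.
transitivity (\sum_(0 <= n <oo) \sum_(0 <= k <oo) c k n)%E.
  apply: eq_eseriesr => n _; rewrite (nneseries_split 0 n.+1)// add0n.
  rewrite [X in (_ + X)%E]eseries0 ?adde0; last first.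
    by move=> i ni _; rewrite /c cpow_small// mulr0 mul0r.
  by rewrite /pcomp mulr_suml -sumEFin big_mkord.
rewrite nneseries_interchange//; apply: eq_eseriesr => k _.
rewrite EFinM -(psum_cpow k a0 t0 tA) -nneseriesZl; last first.
  by move=> n _; rewrite lee_fin mulr_ge0 ?exprn_ge0 ?cpow_ge0.
by apply: eq_eseriesr => n _; rewrite /c -mulrA.
Qed.

Definition shiftX m n := if n is n'.+1 then m n' else 0.

Lemma shiftX_ge0 m : (forall n, 0 <= m n) -> forall n, 0 <= shiftX m n.
Proof. by move=> m0 []. Qed.

Lemma psum_recl a t : (forall n, 0 <= a n) -> 0 <= t ->
  psum a t = ((a 0)%:E + t%:E * psum (fun n => a n.+1) t)%E.
Proof.
move=> a0 t0; rewrite /psum nneseries_recl//; last first.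
  by move=> n _; exact: psum_term_ge0.
rewrite expr0 mulr1 -nneseries_addn; last by move=> n; exact: psum_term_ge0.
rewrite -nneseriesZl//; last first.
  by move=> n _; rewrite lee_fin mulr_ge0 ?exprn_ge0.
congr (_ + _)%E; apply: eq_eseriesr => n _; rewrite addn1 -EFinM; congr EFin.
by rewrite exprS; ring.
Qed.

Lemma psum_shiftX m t : (forall n, 0 <= m n) -> 0 <= t ->
  psum (shiftX m) t = (t%:E * psum m t)%E.
Proof.
by move=> m0 t0; rewrite psum_recl ?add0e//; exact: shiftX_ge0.
Qed.

Lemma psum_fin_tl a t : (forall n, 0 <= a n) -> 0 < t ->
  (psum a t < +oo)%E -> (psum (fun n => a n.+1) t < +oo)%E.
Proof.
move=> a0 t_gt0; rewrite psum_recl ?ltW// => fin.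
rewrite ltey; apply/eqP => E; move: fin; rewrite E.
by rewrite gt0_muley ?lte_fin// addey.
Qed.

(** Let t tend to 0: a(t) is at least [a 0], while b(t) exceeds [b 0] by at most t times the tail of
    [b] evaluated at [d]. *)
Lemma psum_le_coef0 a b (d : R) : (forall n, 0 <= a n) ->
  (forall n, 0 <= b n) -> 0 < d -> (psum b d < +oo)%E ->
  (forall t, 0 < t -> t <= d -> (psum a t <= psum b t)%E) -> a 0 <= b 0.
Proof.
move=> a0 b0 d0 bfin ab; apply/ler_addgt0Pr => e e0.
have C0 := @psum_ge0 (fun n => b n.+1) d (fun n => b0 n.+1) (ltW d0).
have Cfin := psum_fin_tl b0 d0 bfin.
have CE := fineK (psum_fin_num (fun n => b0 n.+1) (ltW d0) Cfin).
set C := fine _ in CE; rewrite -CE lee_fin in C0.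
(* This choice makes the excess [t * C] at most [e]; adding 1 to [C] avoids a zero denominator. *)
pose t := Num.min d (e / (C + 1)).
have C1 : 0 < C + 1 by rewrite ltr_wpDl.
have t0 : 0 < t by rewrite lt_min d0 divr_gt0.
have td : t <= d by rewrite ge_min lexx.
have tC : t * C <= e.
  have : t * (C + 1) <= e by rewrite -ler_pdivlMr// ge_min lexx orbT.
  by apply: le_trans; rewrite ler_wpM2l ?(ltW t0)// lerDl.
rewrite -lee_fin; apply: (@le_trans _ _ (psum a t)).
  rewrite psum_recl ?(ltW t0)// leeDl// mule_ge0 ?lee_fin ?(ltW t0)//.
  by rewrite psum_ge0 ?(ltW t0).
apply: (le_trans (ab _ t0 td)); rewrite psum_recl ?(ltW t0)// EFinD leeD2l//.
apply: (@le_trans _ _ (t * C)%:E); last by rewrite lee_fin.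
rewrite EFinM CE lee_wpmul2l ?lee_fin ?(ltW t0)//.
by rewrite psum_homo ?(ltW t0).
Qed.

(** Induction on [n]: the constant terms agree by [psum_le_coef0]; cancelling them and dividing by t
    leaves the same hypothesis for the shifted sequences. *)
Lemma psum_inj a b (d : R) : (forall n, 0 <= a n) -> (forall n, 0 <= b n) ->
  0 < d -> (psum a d < +oo)%E ->
  (forall t, 0 < t -> t <= d -> psum a t = psum b t) -> forall n, a n = b n.
Proof.
move=> + + d0 + + n; elim: n a b => [|n IH] a b a0 b0 afin ab;
  have ab0 : a 0 = b 0.
- by apply/eqP; rewrite eq_le !(@psum_le_coef0 _ _ d)// -?ab// => t *;
    rewrite ab.
- exact: ab0.
- by apply/eqP; rewrite eq_le !(@psum_le_coef0 _ _ d)// -?ab// => t *;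
    rewrite ab.
apply: (IH (fun n => a n.+1) (fun n => b n.+1)) => //.
  exact: psum_fin_tl.
move=> t t_gt0 td; have t0 := ltW t_gt0; move: (ab t t_gt0 td).
rewrite (psum_recl a0)// (psum_recl b0)// ab0 => H.
have /(congr1 (fun x => (t^-1)%:E * x)%E) :
    (t%:E * psum (fun n => a n.+1) t = t%:E * psum (fun n => b n.+1) t)%E.
  (* The cancelled term is finite, so cancellation is valid whatever the two remainders are. *)
  move: H; set x := (_ * psum _ _)%E; set y := (_ * psum _ _)%E.
  by move: x y => [x||] [y||] //= -[/addrI ->].
by rewrite !muleA -EFinM mulVf ?gt_eqF// !mul1e.
Qed.

End nonneg_power_series.

(** * The fixed-point equation M(v) = F(v M(v)) and its supersolutions *)

Section fixpoint.
Context {R : realType}.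
Variables (f m : nat -> R).
Hypotheses (f0 : forall n, 0 <= f n) (m0 : forall n, 0 <= m n).
Hypothesis mE : forall n, m n = pcomp f (shiftX m) n.

Lemma psum_fixpoint (v A : R) : 0 <= v -> psum m v = A%:E ->
  psum f (v * A) = A%:E.
Proof.
move=> v0 mA; rewrite -mA -(psum_pcomp f0 (shiftX_ge0 m0) _ v0)//.
  by apply: eq_eseriesr => n _; rewrite -mE.
by rewrite psum_shiftX// mA.
Qed.

(* A supersolution dominates the minimal solution: the first n.+1 coefficients of
   pcomp f (shiftX m) only involve the first n coefficients of m. *)
Lemma psum_supersolution (v u A : R) : 0 <= v -> 0 <= u -> psum f u = A%:E ->
  v * A <= u -> (psum m v <= A%:E)%E.
Proof.
move=> v0 u0 fA vAu; apply: psum_le_partial => // N; elim: N => [|N IH].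
  by rewrite big_nil -fA psum_ge0.
(* The next partial sum only sees [m] below [N], so [m] is replaced by its truncation. Its sum [S]
   satisfies [v * S <= v * A <= u], and monotonicity of [f] returns the bound [A]. *)
pose mN n := if (n < N)%N then m n else 0.
have mN0 n : 0 <= mN n by rewrite /mN; case: ifP.
set S := \sum_(0 <= n < N) _ in IH.
have SE : psum mN v = S%:E.
  rewrite /psum (nneseries_split 0 N) ?add0n; last first.
    by move=> n _; exact: psum_term_ge0.
  rewrite [X in (_ + X)%E]eseries0 ?adde0; last first.
    by move=> i Ni _; rewrite /mN ltnNge Ni mul0r.
  rewrite -sumEFin big_nat [RHS]big_nat; apply: eq_bigr => i /andP[_ iN].
  by rewrite /mN iN.
have S0 : 0 <= S by rewrite -lee_fin -SE psum_ge0.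
have -> : \sum_(0 <= n < N.+1) m n * v ^+ n =
          \sum_(0 <= n < N.+1) pcomp f (shiftX mN) n * v ^+ n.
  rewrite big_nat [RHS]big_nat; apply: eq_bigr => n /andP[_ nN].
  rewrite mE; congr (_ * _); apply: eq_pcomp => -[|j] //= jn.
  by rewrite /mN (leq_trans jn).
apply: (le_trans (partial_le_psum _ (pcomp_ge0 f0 (shiftX_ge0 mN0)) v0)).
rewrite (psum_pcomp (A := v * S) f0 (shiftX_ge0 mN0))//; last first.
  by rewrite psum_shiftX// SE.
rewrite -fA psum_homo ?mulr_ge0//; apply: le_trans vAu.
by rewrite ler_wpM2l.
Qed.

End fixpoint.

(** * Derivatives and tangent inequalities *)

Section power_series_calculus.
Context {R : realType}.
Implicit Types (a : nat -> R) (t u : R).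

Definition pderiv a n := n.+1%:R * a n.+1.

Lemma pderiv_ge0 a : (forall n, 0 <= a n) -> forall n, 0 <= pderiv a n.
Proof. by move=> a0 n; rewrite mulr_ge0. Qed.

Lemma psum_pderivE a t : (forall n, 0 <= a n) -> 0 <= t ->
  psum (pderiv a) t = (\sum_(0 <= n <oo) (n%:R * a n * t ^+ n.-1)%:E)%E.
Proof.
move=> a0 t0; rewrite [RHS]nneseries_recl//; last first.
  by move=> n _; rewrite lee_fin !mulr_ge0 ?exprn_ge0.
rewrite !mul0r add0e -nneseries_addn; last first.
  by move=> n; rewrite lee_fin !mulr_ge0 ?exprn_ge0.
by apply: eq_eseriesr => n _; rewrite addn1.
Qed.

(** Factor u^n - t^n by u - t and compare each term of the cofactor with a power of t; when u < t,
    the negative factor reverses the comparison. *)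
Lemma expr_tangent t u n : 0 <= t -> 0 <= u ->
  t ^+ n + (u - t) * (n%:R * t ^+ n.-1) <= u ^+ n.
Proof.
move=> t0 u0; case: n => [|n]; first by rewrite !mul0r mulr0 addr0.
rewrite /= -lerBrDl subrXX.
have tnE : n.+1%:R * t ^+ n = \sum_(i < n.+1) t ^+ (n - i) * t ^+ i.
  rewrite (eq_bigr (fun _ => t ^+ n)) ?sumr_const ?card_ord ?mulr_natl// => i _.
  by rewrite -exprD subnK// -ltnS.
rewrite tnE; case: (leP t u) => [tu|/ltW ut].
  rewrite ler_wpM2l ?subr_ge0//; apply: ler_sum => i _.
  by rewrite ler_wpM2r ?exprn_ge0// lerXn2r.
rewrite ler_wnM2l ?subr_le0//; apply: ler_sum => i _.
by rewrite ler_wpM2r ?exprn_ge0// lerXn2r// ltW.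
Qed.

(** Convexity, term by term. It is split from [psum_tangent_ge] according to the order of [t] and
    [u], so that all terms are nonnegative and no infinite sums are subtracted. *)
Lemma psum_tangent_le a t u : (forall n, 0 <= a n) -> 0 <= t -> t <= u ->
  (psum a t + (u - t)%:E * psum (pderiv a) t <= psum a u)%E.
Proof.
move=> a0 t0 tu; have u0 := le_trans t0 tu.
rewrite psum_pderivE// -nneseriesZl; last first.
  by move=> n _; rewrite lee_fin !mulr_ge0 ?exprn_ge0.
rewrite -nneseriesD => [||n _ _]; first last.
  - by rewrite -EFinM lee_fin !mulr_ge0 ?exprn_ge0 ?subr_ge0.
  - by move=> n _ _; exact: psum_term_ge0.
apply: lee_nneseries => [n _ _|n _].
  by rewrite -EFinM lee_fin addr_ge0 ?mulr_ge0 ?exprn_ge0 ?subr_ge0.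
rewrite -EFinM -EFinD lee_fin.
have -> : a n * t ^+ n + (u - t) * (n%:R * a n * t ^+ n.-1) =
          a n * (t ^+ n + (u - t) * (n%:R * t ^+ n.-1)) by ring.
by rewrite ler_wpM2l// expr_tangent.
Qed.

Lemma psum_tangent_ge a t u : (forall n, 0 <= a n) -> 0 <= u -> u <= t ->
  (psum a t <= psum a u + (t - u)%:E * psum (pderiv a) t)%E.
Proof.
move=> a0 u0 ut; have t0 := le_trans u0 ut.
rewrite psum_pderivE// -nneseriesZl; last first.
  by move=> n _; rewrite lee_fin !mulr_ge0 ?exprn_ge0.
rewrite -nneseriesD => [||n _ _]; first last.
  - by rewrite -EFinM lee_fin !mulr_ge0 ?exprn_ge0 ?subr_ge0.
  - by move=> n _ _; exact: psum_term_ge0.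
apply: lee_nneseries => [n _ _|n _]; first exact: psum_term_ge0.
rewrite -EFinM -EFinD lee_fin.
have -> : a n * u ^+ n + (t - u) * (n%:R * a n * t ^+ n.-1) =
          a n * (u ^+ n - (u - t) * (n%:R * t ^+ n.-1)) by ring.
by rewrite ler_wpM2l// lerBrDr expr_tangent.
Qed.

(** The tangent inequality bounds (u - t) a'(t) by a(u). *)
Lemma psum_pderiv_fin a t u : (forall n, 0 <= a n) -> 0 <= t -> t < u ->
  (psum a u < +oo)%E -> (psum (pderiv a) t < +oo)%E.
Proof.
move=> a0 t0 tu fin; have := psum_tangent_le a0 t0 (ltW tu).
move=> /le_lt_trans/(_ fin); rewrite !ltey => /eqP H; apply/eqP => E; apply: H.
rewrite E gt0_muley ?lte_fin ?subr_gt0// addey//.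
by rewrite gt_eqF// (lt_le_trans _ (psum_ge0 a0 t0)).
Qed.

End power_series_calculus.

(** * Continuity, including left limits at the boundary *)

Section power_series_continuity.
Context {R : realType}.
Implicit Types (a : nat -> R) (t u r : R).

Lemma psum_lipschitz a t u r : (forall n, 0 <= a n) -> 0 <= t -> t <= u ->
  u < r -> (psum a r < +oo)%E ->
  0 <= fine (psum a u) - fine (psum a t) <= fine (psum (pderiv a) u) * (u - t).
Proof.
move=> a0 t0 tu ur fin; have u0 := le_trans t0 tu.
have ufin : psum a u \is a fin_num.
  apply: psum_fin_num => //; apply: le_lt_trans fin; exact: psum_homo (ltW ur).
have tfin : psum a t \is a fin_num.
  apply: psum_fin_num => //; apply: le_lt_trans (psum_homo a0 t0 tu) _.
  by rewrite -ge0_fin_numE// psum_ge0.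
have dfin : psum (pderiv a) u \is a fin_num.
  by apply: psum_fin_num (psum_pderiv_fin a0 u0 ur fin) => //; exact: pderiv_ge0.
have := psum_homo a0 t0 tu; have := psum_tangent_ge a0 t0 tu.
rewrite -(fineK ufin) -(fineK tfin) -(fineK dfin) -EFinM -EFinD !lee_fin !fineK//.
by rewrite subr_ge0 => H ->; rewrite lerBlDl mulrC.
Qed.

(** The sum is Lipschitz on [0, t0] with constant a'(t0), which is finite because the series
    converges at [r], beyond [t0]. *)
Lemma psum_continuous a t0 r : (forall n, 0 <= a n) -> 0 <= t0 -> t0 < r ->
  (psum a r < +oo)%E ->
  {within `[0, t0], continuous (fun t => fine (psum a t))}.
Proof.
move=> a0 t00 t0r fin.
have d0 := pderiv_ge0 a0.
have dfin : psum (pderiv a) t0 \is a fin_num.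
  exact: psum_fin_num d0 t00 (psum_pderiv_fin a0 t00 t0r fin).
set C := fine (psum (pderiv a) t0).
have C0 : 0 <= C by rewrite fine_ge0// psum_ge0.
have lip t u : 0 <= t -> t <= u -> u <= t0 ->
    `|fine (psum a u) - fine (psum a t)| <= C * (u - t).
  move=> tp tu ut; have ur := le_lt_trans ut t0r; have u0 := le_trans tp tu.
  have /andP[p q] := psum_lipschitz a0 tp tu ur fin.
  rewrite ger0_norm//; apply: (le_trans q); rewrite ler_wpM2r ?subr_ge0//.
  apply: fine_le => //; last exact: psum_homo.
  exact: psum_fin_num d0 u0 (psum_pderiv_fin a0 u0 ur fin).
apply/subspace_continuousP => x /=; rewrite in_itv/= => /andP[x0 xt].
apply/cvgrPdist_le => e e0.
have C1 : 0 < C + 1 by rewrite ltr_wpDl.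
rewrite near_withinE; near=> y => /=; rewrite in_itv/= => /andP[y0 yt].
have xy : `|x - y| <= e / (C + 1).
  by near: y; apply: cvgr_dist_le; [exact: cvg_id|rewrite divr_gt0].
apply: (@le_trans _ _ (C * `|x - y|)).
  have [yx|/ltW xy'] := leP y x.
    by rewrite [X in _ <= _ * X]ger0_norm ?subr_ge0// lip.
  by rewrite distrC [`|x - y|]distrC [X in _ <= _ * X]ger0_norm ?subr_ge0// lip.
apply: (@le_trans _ _ ((C + 1) * `|x - y|)); first by rewrite ler_wpM2r// lerDl.
by rewrite mulrC -ler_pdivlMr.
Unshelve. all: by end_near. Qed.

Lemma partial_cvg_left a r N :
  \sum_(0 <= n < N) a n * t ^+ n @[t --> r^'-] --> \sum_(0 <= n < N) a n * r ^+ n.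
Proof.
apply: cvg_at_left_filter; elim: N => [|N IH].
  under eq_fun do rewrite big_nil.
  by rewrite big_nil; exact: cvg_cst.
under eq_fun do rewrite big_nat_recr//=.
rewrite big_nat_recr//=; apply: cvgD; first exact: IH.
by apply: cvgMr; exact: exprn_continuous.
Qed.

(** Abel's limit theorem for nonnegative coefficients: a partial sum within e / 2 of the value at
    [r] is continuous and bounds the sum at t < r from below. *)
Lemma psum_cvg_left a r : (forall n, 0 <= a n) -> 0 < r -> (psum a r < +oo)%E ->
  fine (psum a t) @[t --> r^'-] --> fine (psum a r).
Proof.
move=> a0 r0 fin; apply/cvgrPdist_le => e e0.
have rfin : psum a r \is a fin_num by rewrite psum_fin_num// ltW.
have [N HN] : exists N, fine (psum a r) - e / 2 <
    \sum_(0 <= n < N) a n * r ^+ n.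
  apply: contrapT => /forallNP H.
  have : (psum a r <= (fine (psum a r) - e / 2)%:E)%E.
    apply: psum_le_partial => // [|N]; first exact: ltW.
    by rewrite lee_fin leNgt; apply/negP.
  rewrite -{1}(fineK rfin) lee_fin => H'.
  by move: e0 H'; lra.
near=> t.
have t0 : 0 <= t by near: t; exact: nbhs_left_ge.
have tr : t <= r by near: t; exact: nbhs_left_le.
have tfin : psum a t \is a fin_num.
  by rewrite psum_fin_num// (le_lt_trans _ fin)// psum_homo.
have H1 : fine (psum a t) <= fine (psum a r) by rewrite fine_le// psum_homo.
have H2 : \sum_(0 <= n < N) a n * t ^+ n <= fine (psum a t).
  by rewrite -lee_fin fineK// partial_le_psum.
have H3 : `|\sum_(0 <= n < N) a n * r ^+ n -
            \sum_(0 <= n < N) a n * t ^+ n| <= e / 2.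
  by near: t; apply: cvgr_dist_le; [exact: partial_cvg_left|rewrite divr_gt0].
rewrite ger0_norm ?subr_ge0//; move: H3; rewrite ler_norml => /andP[_].
by move: HN H2; lra.
Unshelve. all: by end_near. Qed.

(** The bound passes to the limit in each partial sum, so finiteness at [r] is a consequence. *)
Lemma psum_le_left a r (x : R) : (forall n, 0 <= a n) -> 0 < r ->
  (forall t, 0 < t -> t < r -> (psum a t <= x%:E)%E) -> (psum a r <= x%:E)%E.
Proof.
move=> a0 r0 H; apply: psum_le_partial => // [|N]; first exact: ltW.
rewrite lee_fin; apply: (cvgr_to_le (partial_cvg_left (a := a) (r := r) (N := N))).
near=> t.
have t0 : 0 < t by near: t; exact: nbhs_left_gt.
have tr : t < r by near: t; exact: nbhs_left_lt.
by rewrite -lee_fin (le_trans _ (H t t0 tr))// partial_le_psum// ltW.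
Unshelve. all: by end_near. Qed.

End power_series_continuity.

(** * Radius of convergence *)

Section radius_of_convergence.
Context {R : realType}.
Variable kappa : nat -> R.
Hypothesis kappa_ge0 : forall n, (1 <= n)%N -> 0 <= kappa n.

Let a n := kappa n.+1.
Let a0 n : 0 <= a n. Proof. exact: kappa_ge0. Qed.

Let rt n : \bar R := (kappa n `^ n%:R^-1)%:E.
Let rt0 : (0 <= limn_esup rt)%E.
Proof.
apply: limf_esup_ge0 => [|n]; first exact: filter_not_empty.
by rewrite lee_fin powR_ge0.
Qed.

Lemma powR_invnK (x : R) n : 0 <= x -> (x ^+ n.+1) `^ n.+1%:R^-1 = x.
Proof.
by move=> x0; rewrite -powR_mulrn// -powRrM divff ?powRr1// pnatr_eq0.
Qed.

(** The terms of a convergent series tend to 0, which bounds the roots of the cumulants eventually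
    by 1 / t. *)
Lemma le_conv_radius (t : R) : 0 < t -> (Rtrans kappa t < +oo)%E ->
  (t%:E <= conv_radius kappa)%E.
Proof.
move=> t0 fin.
have t0' := ltW t0.
have cv0 : a n * t ^+ n @[n --> \oo] --> 0.
  by apply/cvg_series_cvg_0/nnseries_is_cvg => // n; rewrite mulr_ge0 ?exprn_ge0.
rewrite /conv_radius inve_pge ?inE ?lee_fin// inver gt_eqF//.
(* The threshold [t^-1] absorbs the index shift: it turns into [kappa n.+1 <= t^-1 ^+ n.+1]. *)
have [N _ HN] : \forall n \near \oo, a n * t ^+ n <= t^-1.
  have := cvgr_le 0 cv0 t^-1; apply; by rewrite invr_gt0.
rewrite /limn_esup limf_esupE; apply: ge_ereal_inf => /=.
exists (ereal_sup [set rt n | n in [set n | (N < n)%N]]).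
  by exists [set n | (N < n)%N] => //; exact: nbhs_infty_gt.
apply: ge_ereal_sup => _ [[|n] //= Nn <-]; rewrite lee_fin.
have tV0 : 0 <= t^-1 by rewrite invr_ge0.
rewrite -[leRHS](powR_invnK n tV0) ge0_ler_powR ?nnegrE ?invr_ge0 ?exprn_ge0//.
  exact: a0.
have := HN n Nn; rewrite /= -ler_pdivlMr ?exprn_gt0// exprVn exprS invfM.
exact.
Qed.


(** Root test: for t < u < t1 below the radius, the terms at [t1] are bounded, so the series at [u]
    is dominated by a geometric one of ratio [u / t1]. *)
Lemma lt_conv_radius (t : R) : 0 <= t -> (t%:E < conv_radius kappa)%E ->
  exists2 u, t < u & (Rtrans kappa u < +oo)%E.
Proof.
move=> t0 tr.
have [t1 tt1 t1r] : exists2 t1, t < t1 & (t1%:E < conv_radius kappa)%E.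
  case: (conv_radius kappa) tr => [r||] //; rewrite ?lte_fin => tr.
    by exists ((t + r) / 2); rewrite ?lte_fin ?midf_lt.
  by exists (t + 1); rewrite ?ltry// ltrDl.
have [u tu ut1] : exists2 u, t < u & u < t1.
  by exists ((t + t1) / 2); rewrite midf_lt.
exists u => //.
have t10 : 0 < t1 by exact: le_lt_trans tt1.
have u_gt0 : 0 < u by exact: le_lt_trans tu.
have u0 := ltW u_gt0.
move: t1r; rewrite /conv_radius inve_pgt ?inE ?lee_fin ?(ltW t10)//.
rewrite inver gt_eqF//.
rewrite /limn_esup limf_esupE => /ereal_inf_lt[_ [V [N _ NV] <-] ltV].
have bnd n : (N <= n)%N -> a n * t1 ^+ n <= t1^-1.
  move=> Nn.
  have : (rt n.+1 <= t1^-1%:E)%E.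
    apply: le_trans (ltW ltV); apply: ereal_sup_ubound; exists n.+1 => //.
    by apply: NV => /=; exact: leqW.
  rewrite lee_fin => H.
  have tV0 : 0 <= t1^-1 by rewrite invr_ge0 ltW.
  have : a n <= t1^-1 ^+ n.+1.
    rewrite -(@powRr1 _ (a n))// -(@mulVf _ n.+1%:R) ?pnatr_eq0// powRrM.
    by rewrite powR_mulrn ?powR_ge0// lerXn2r// nnegrE ?powR_ge0.
  by rewrite exprS exprVn ler_pdivlMr ?exprn_gt0.
(* The sum covers the terms before [N] and [t1^-1] the later ones. *)
pose C := \sum_(0 <= n < N) a n * t1 ^+ n + t1^-1.
have sum0 k l : 0 <= \sum_(k <= n < l) a n * t1 ^+ n.
  by apply: sumr_ge0 => i _; rewrite mulr_ge0 ?exprn_ge0 ?(ltW t10).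
have bndC n : a n * t1 ^+ n <= C.
  have [Nn|nN] := leqP N n; first by rewrite (le_trans (bnd n Nn))// lerDr.
  rewrite /C (big_cat_nat (n := n.+1))//= big_nat_recr//=.
  have q : 0 <= t1^-1 by rewrite invr_ge0 ltW.
  by have := sum0 0%N n; have := sum0 n.+1 N; move: q; lra.
have C0 : 0 <= C by rewrite addr_ge0 ?invr_ge0 ?(ltW t10).
have q1 : u / t1 < 1 by rewrite ltr_pdivrMr// mul1r.
have q0 : 0 < u / t1 by rewrite divr_gt0.
apply: (@le_lt_trans _ _ (C / (1 - u / t1))%:E); last exact: ltry.
apply: psum_le_partial => // N'; rewrite lee_fin.
apply: (@le_trans _ _ (\sum_(0 <= n < N') C * (u / t1) ^+ n)).
  apply: ler_sum => n _; rewrite expr_div_n mulrA ler_pdivlMr ?exprn_gt0//.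
  by rewrite mulrAC ler_wpM2r ?exprn_ge0//; exact: bndC.
rewrite -mulr_sumr ler_wpM2l//.
have := geometric_le_lim N' ler01 q0; rewrite ger0_norm ?(ltW q0)// => /(_ q1).
rewrite div1r; apply: le_trans; rewrite /series /geometric/=.
by under [leRHS]eq_bigr do rewrite mul1r.
Qed.

Lemma Rtrans'E (t : R) : 0 <= t -> Rtrans' kappa t = psum (pderiv a) t.
Proof.
move=> t0; rewrite /Rtrans' -nneseries_addn; last first.
  by move=> [|n]; rewrite lee_fin ?addn0 ?addn1/= !mulr_ge0 ?exprn_ge0 ?kappa_ge0.
by apply: eq_eseriesr => n _; rewrite addn1.
Qed.

End radius_of_convergence.

(** * Minimization of 1 / u + R(u) *)

Section minimization.
Context {R : realType}.
Variables (kappa : nat -> R) (s : R).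
Hypothesis kappa_ge0 : forall n, (1 <= n)%N -> 0 <= kappa n.
Hypothesis kappa_gt0 : exists2 k, (2 <= k)%N & 0 < kappa k.
Hypothesis s_le : forall u r : R, 0 < u -> Rtrans kappa u = r%:E ->
  s <= u^-1 + r.
Hypothesis s_approx : forall x : R, s < x -> exists u r : R,
  [/\ 0 < u, Rtrans kappa u = r%:E & u^-1 + r = x].

Let a n := kappa n.+1.
Let a0 n : 0 <= a n. Proof. exact: kappa_ge0. Qed.
Let d0 n : 0 <= pderiv a n. Proof. exact: pderiv_ge0. Qed.
Let R'E := Rtrans'E kappa_ge0.
Let RE t : psum a t = Rtrans kappa t. Proof. by []. Qed.

(** The series of t^2 R'(t): the critical equation becomes [psum b x = 1], whose left side is
    nondecreasing. *)
Let b := shiftX (shiftX (pderiv a)).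
Let b0 n : 0 <= b n. Proof. by do 2 apply: shiftX_ge0 => {}n; exact: d0. Qed.

Let psum_b (t : R) : 0 <= t -> psum b t = ((t ^+ 2)%:E * Rtrans' kappa t)%E.
Proof.
move=> t0; rewrite R'E// psum_shiftX//; last exact: shiftX_ge0.
by rewrite psum_shiftX// muleA -EFinM expr2.
Qed.

(** Termwise, R(t) is at most [a 0] plus t R'(t). *)
Lemma Rtrans_fin (t : R) : 0 <= t -> (Rtrans' kappa t < +oo)%E ->
  Rtrans kappa t \is a fin_num.
Proof.
move=> t0; rewrite R'E// => fin; apply: psum_fin_num => //.
rewrite (psum_recl a0)//.
apply: (@le_lt_trans _ _ ((a 0)%:E + t%:E * psum (pderiv a) t)%E).
  rewrite leeD2l// lee_wpmul2l//; apply: le_psum => // n.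
  by rewrite ler_peMl// ler1n.
by rewrite -(fineK (psum_fin_num d0 t0 fin)) -EFinM -EFinD ltry.
Qed.

(** With K(u) = 1 / u + R(u), the tangent of R at [x] gives K(u) - K(x) >= (x - u) (1 / (u x) - d),
    so the hypothesis makes [x] a minimizer. The values of K lie above [s] and come arbitrarily
    close to it. *)
Lemma eq_min_tangent (x d : R) : 0 < x -> Rtrans' kappa x = d%:E ->
  (forall u, 0 < u -> (Rtrans kappa u < +oo)%E ->
    0 <= (x - u) * (u^-1 * x^-1 - d)) ->
  s%:E = ((1 / x)%:E + Rtrans kappa x)%E.
Proof.
move=> x0 dE H.
have fin : Rtrans kappa x \is a fin_num.
  by apply: Rtrans_fin; rewrite ?(ltW x0)// dE ltry.
rewrite -(fineK fin) -EFinD div1r; congr EFin; apply/eqP.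
rewrite eq_le s_le ?fineK//=; apply/ler_addgt0Pr => e e0.
have [|u [r [u0 rE <-]]] := s_approx (x := s + e); first by rewrite ltrDl.
have /H : (Rtrans kappa u < +oo)%E by rewrite rE ltry.
move=> /(_ u0).
have -> : (x - u) * (u^-1 * x^-1 - d) = u^-1 - x^-1 - (x - u) * d.
  by rewrite mulrBr; congr (_ - _); field; rewrite !gt_eqF.
have : fine (Rtrans kappa x) <= r + (x - u) * d.
  rewrite -lee_fin EFinD EFinM fineK//.
  have [ux|/ltW xu] := leP u x.
    by rewrite -rE -dE R'E ?(ltW x0)// psum_tangent_ge// ltW.
  have := psum_tangent_le a0 (ltW x0) xu.
  rewrite -R'E ?(ltW x0)// !RE rE dE -(fineK fin).
  by rewrite -EFinM -EFinD !lee_fin; lra.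
lra.
Qed.

Definition critical (x : R) := [/\ 0 < x, (x%:E <= conv_radius kappa)%E
  & Rtrans' kappa x = (1 / x ^+ 2)%:E].

(** At a critical point the product in [eq_min_tangent] is (x - u)^2 / (u x^2). *)
Lemma critical_min (x : R) : critical x ->
  s%:E = ((1 / x)%:E + Rtrans kappa x)%E.
Proof.
move=> [x0 _ xE]; apply: eq_min_tangent xE _ => // u u0 _.
have -> : (x - u) * (u^-1 * x^-1 - 1 / x ^+ 2) = (x - u) ^+ 2 / (u * x ^+ 2).
  by field; rewrite !gt_eqF.
by rewrite divr_ge0 ?sqr_ge0// mulr_ge0 ?sqr_ge0// ltW.
Qed.

(** Finiteness of R(u) forces u <= x, and then d <= 1 / x^2 <= 1 / (u x): both factors are
    nonnegative. *)
Lemma radius_min (x d : R) : 0 < x -> conv_radius kappa = x%:E ->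
  Rtrans' kappa x = d%:E -> d <= 1 / x ^+ 2 ->
  s%:E = ((1 / x)%:E + Rtrans kappa x)%E.
Proof.
move=> x0 xE dE dx; apply: eq_min_tangent dE _ => // u u0 ufin.
have ux : u <= x by rewrite -lee_fin -xE; exact: le_conv_radius.
rewrite mulr_ge0 ?subr_ge0//; apply: (le_trans dx).
by rewrite div1r expr2 invfM ler_wpM2r ?invr_ge0 ?(ltW x0)// lef_pV2.
Qed.

(** R' is nondecreasing whereas 1 / x^2 is strictly decreasing. *)
Lemma critical_inj (x y : R) : critical x -> critical y -> x = y.
Proof.
have le z t : critical z -> critical t -> z <= t.
  move=> [z0 _ zE] [t0 _ tE]; rewrite leNgt; apply/negP => tz.
  have := psum_homo d0 (ltW t0) (ltW tz).
  rewrite -!R'E ?(ltW t0) ?(ltW z0)// zE tE lee_fin !div1r lef_pV2 ?posrE ?exprn_gt0//.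
  by rewrite leNgt ltrXn2r// (ltW t0).
by move=> cx cy; apply/eqP; rewrite eq_le !le.
Qed.

Lemma conv_radius_gt0 : (0 < conv_radius kappa)%E.
Proof.
have [|u [r [u0 rE _]]] := s_approx (x := s + 1); first by rewrite ltrDl.
apply: (@lt_le_trans _ _ u%:E); first by rewrite lte_fin.
by apply: le_conv_radius => //; rewrite rE ltry.
Qed.

(** Either t^2 R'(t) reaches 1 before the radius, and the intermediate value theorem applies, or it
    stays below 1; then the radius is finite and the value there decides. *)
Lemma critical_or_radius : (exists x, critical x) \/
  exists x d : R, [/\ 0 < x, conv_radius kappa = x%:E, Rtrans' kappa x = d%:E
                 & d < 1 / x ^+ 2].
Proof.
have critE x : 0 < x -> (x%:E <= conv_radius kappa)%E -> psum b x = 1%:E ->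
    critical x.
  move=> x0 xr; rewrite psum_b ?ltW// => E; split => //.
  transitivity (((x ^+ 2)^-1)%:E * ((x ^+ 2)%:E * Rtrans' kappa x))%E.
    by rewrite muleA -EFinM mulVf ?mul1e// sqrf_eq0 gt_eqF.
  by rewrite E mule1 div1r.
have [[t0 [t00 t0r Nt0]]|H] := pselect (exists t0, [/\ 0 < t0,
    (t0%:E < conv_radius kappa)%E & (1%:E <= psum b t0)%E]).
  (* There is room beyond [t0]: R converges at some [u > r > t0], so t^2 R'(t) is finite at [r] and
     continuous on [0, t0]. *)
  left; have [u t0u ufin] := lt_conv_radius kappa_ge0 (ltW t00) t0r.
  have [r t0r' ru] : exists2 r, t0 < r & r < u.
    by exists ((t0 + u) / 2); rewrite midf_lt.
  have r0 : 0 < r by exact: lt_trans t0r'.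
  have bfin : (psum b r < +oo)%E.
    have := psum_pderiv_fin a0 (ltW r0) ru ufin.
    move=> /(psum_fin_num d0 (ltW r0))/fineK; rewrite psum_b ?R'E ?(ltW r0)// => <-.
    by rewrite -EFinM ltry.
  have cont := psum_continuous b0 (ltW t00) t0r' bfin.
  have bt t : 0 <= t -> t <= t0 -> psum b t \is a fin_num.
    move=> tp tt0; rewrite psum_fin_num// (le_lt_trans _ bfin)// psum_homo//.
    exact: le_trans (ltW t0r').
  have f00 : fine (psum b 0) = 0 by rewrite psum_b// expr0n mul0e.
  have f01 : 1 <= fine (psum b t0) by rewrite -lee_fin fineK// bt// ltW.
  have [|x] := IVT (v := 1) (ltW t00) cont.
    by rewrite f00 ge_min le_max ler01 f01 orbT.
  rewrite in_itv/= => /andP[x0 xt] xE; exists x; apply: critE.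
  - rewrite lt_neqAle x0 andbT; apply/eqP => x0'.
    by move: xE; rewrite -x0' f00 => /esym/eqP; rewrite oner_eq0.
  - by apply: le_trans (ltW t0r); rewrite lee_fin.
  - by rewrite -(fineK (bt x x0 xt)) xE.
have {}H t : 0 < t -> (t%:E < conv_radius kappa)%E -> (psum b t <= 1%:E)%E.
  by move=> tp tr; rewrite leNgt; apply/negP => /ltW bt; apply: H; exists t.
have [x xE] : exists x, conv_radius kappa = x%:E.
  move: conv_radius_gt0 H; case: (conv_radius kappa) => [x _ _|_ H|//].
    by exists x.
  have [[|[|k]] // _ kk] := kappa_gt0.
  have bk : 0 < b k.+2 by rewrite mulr_gt0.
  (* As [t >= 1], a single term of the series is at least [b k.+2 * t = b k.+2 + 2 > 1], which
     excludes an infinite radius. *)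
  pose t := 1 + 2 / b k.+2.
  have t1 : 1 <= t by rewrite lerDl divr_ge0// ltW.
  have tp : 0 < t by exact: lt_le_trans t1.
  have : ((b k.+2 * t ^+ k.+2)%:E <= 1%:E)%E.
    apply: le_trans (H t tp (ltry _)).
    apply: le_trans (partial_le_psum k.+3 b0 (ltW tp)).
    rewrite lee_fin big_nat_recr//= lerDr.
    by apply: sumr_ge0 => i _; rewrite mulr_ge0// exprn_ge0// ltW.
  rewrite lee_fin leNgt => /negP[].
  apply: (@lt_le_trans _ _ (b k.+2 * t)).
    by rewrite mulrDr mulr1 mulrCA divff ?gt_eqF//; move: bk; lra.
  by rewrite ler_wpM2l ?(ltW bk)// ler_eXnr.
have x0 : 0 < x by rewrite -lte_fin -xE conv_radius_gt0.
(* The bound extends to the radius, where equality means that the radius itself is critical. *)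
have : (psum b x <= 1%:E)%E.
  by apply: psum_le_left => // t tp tx; apply: H => //; rewrite xE lte_fin.
rewrite le_eqVlt => /orP[/eqP bx|bx].
  by left; exists x; apply: critE => //; rewrite xE.
right; exists x, (fine (Rtrans' kappa x)).
have fin : Rtrans' kappa x \is a fin_num.
  rewrite R'E ?psum_fin_num ?(ltW x0)// -R'E ?(ltW x0)// ltey; apply/eqP => E.
  by move: bx; rewrite psum_b ?(ltW x0)// E gt0_muley ?lte_fin ?exprn_gt0.
split => //; first by rewrite fineK.
rewrite ltr_pdivlMr ?exprn_gt0// mulrC -lte_fin EFinM fineK//.
by rewrite -psum_b// ltW.
Qed.

(** R and R' are left continuous at the radius, so the limit is the value of the quotient there; [D]
    is its denominator x R(x) + 1. *)
Lemma nu_radius (x d : R) : 0 < x -> conv_radius kappa = x%:E ->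
  Rtrans' kappa x = d%:E ->
  exists2 D, 0 < D & nu kappa = (1 + (x ^+ 2 * d - 1) / D)%:E.
Proof.
move=> x0 xE dE.
have fin : Rtrans kappa x \is a fin_num by apply: Rtrans_fin; rewrite ?dE ?ltry ?ltW.
exists (x * fine (Rtrans kappa x) + 1).
  by rewrite ltr_wpDl// mulr_ge0 ?(ltW x0)// fine_ge0// psum_ge0// ltW.
have cd : fine (Rtrans' kappa t) @[t --> x^'-] --> d.
  have := @psum_cvg_left _ _ _ d0 x0; rewrite -R'E ?(ltW x0)// dE ltry /= => /(_ isT).
  apply: cvg_trans; apply: near_eq_cvg; near=> t; rewrite R'E//.
  by near: t; exact: nbhs_left_ge.
have cr : fine (Rtrans kappa t) @[t --> x^'-] --> fine (Rtrans kappa x).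
  by apply: (@psum_cvg_left _ _ _ a0 x0); rewrite -ge0_fin_numE// psum_ge0// ltW.
have cx : (t @[t --> x^'-] --> x) by apply: cvg_at_left_filter; exact: cvg_id.
rewrite /nu xE /= EFinD; congr (_ + _)%E; apply/cvg_lim => //.
apply: cvg_EFin; first exact: nearW.
apply: cvgM.
  apply: cvgB; last exact: cvg_cst.
  by apply: cvgM => //; apply: cvgM.
apply: cvgV.
  rewrite gt_eqF// ltr_wpDl// mulr_ge0 ?(ltW x0)// fine_ge0// psum_ge0// ltW//.
by apply: cvgD; [exact: cvgM|exact: cvg_cst].
Unshelve. all: by end_near. Qed.

(** If [x] is the radius, the numerator vanishes in the limit. Otherwise t^2 R'(t) >= 1 between [x]
    and the radius, so the quotient is nonnegative there. *)
Lemma critical_nu (x : R) : critical x -> (1 <= nu kappa)%E.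
Proof.
move=> [x0]; rewrite le_eqVlt => /orP[/eqP xr dE|xr dE].
  have [D _ ->] := nu_radius x0 (esym xr) dE.
  by rewrite mulrCA divff ?mulr1 ?subrr ?mul0r ?addr0// sqrf_eq0 gt_eqF.
set q := fun t => (nu_quotient kappa t)%:E.
have q0 t : x < t -> (t%:E < conv_radius kappa)%E -> (0 <= q t)%E.
  move=> xt tr; have tp := lt_trans x0 xt; have t0 := ltW tp.
  rewrite lee_fin divr_ge0//; last first.
    by rewrite addr_ge0// mulr_ge0// fine_ge0// psum_ge0.
  have [u tu ufin] := lt_conv_radius kappa_ge0 t0 tr.
  have dfin : Rtrans' kappa t \is a fin_num.
    by rewrite R'E// (psum_fin_num d0 t0)// (psum_pderiv_fin a0 t0 tu ufin).
  rewrite subr_ge0 -lee_fin EFinM fineK// -psum_b//.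
  apply: le_trans (psum_homo b0 (ltW x0) (ltW xt)).
  by rewrite psum_b ?(ltW x0)// dE -EFinM mulrCA divff ?mulr1// sqrf_eq0 gt_eqF.
rewrite /nu leeDl//.
(* The quotient is in fact nondecreasing, but its convergence is not needed
   here: the limit of a divergent filter is the default value 0. *)
have [cq|ncq] := pselect (cvg (q t @[t --> ereal_at_left (conv_radius kappa)]));
  last by rewrite (dvgP ncq).
case: (conv_radius kappa) xr q0 cq => [r||] //= xr q0 cq; apply: lime_ge cq _.
  near=> t; apply: q0; first by near: t; exact: nbhs_left_gt.
  by rewrite lte_fin; near: t; exact: nbhs_left_lt.
near=> t; apply: q0; last exact: ltry.
by near: t; apply: nbhs_pinfty_gt; exact: num_real.
Unshelve. all: by end_near. Qed.

Lemma radius_nu (x d : R) : 0 < x -> conv_radius kappa = x%:E ->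
  Rtrans' kappa x = d%:E -> d < 1 / x ^+ 2 -> (nu kappa < 1)%E.
Proof.
move=> x0 xE dE dx; have [D D0 ->] := nu_radius x0 xE dE.
rewrite lte_fin gtrDl pmulr_llt0 ?invr_gt0// subr_lt0.
by rewrite mulrC -ltr_pdivlMr ?exprn_gt0.
Qed.

End minimization.

(** * Moments and support *)

Section support.
Context {R : realType}.
Variable mu : probability (measurableTypeR R) R.

(** Each point off the support lies in a null interval with rational endpoints, and there are
    countably many of these. *)
Lemma negligible_compl_msupport : mu.-negligible (~` msupport mu).
Proof.
pose J (pq : rat * rat) : set (measurableTypeR R) := `]ratr pq.1, ratr pq.2[%classic.
pose F n := if unpickle n is Some pq then
  (if mu (J pq) == 0%E then J pq else set0) else set0.
apply: (@negligibleS _ _ _ _ (\bigcup_n F n)); last first.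
  apply: negligible_bigcup => n; rewrite /F.
  case: (unpickle n) => [pq|]; last exact: negligible_set0.
  case: ifPn => [/eqP I0|_]; last exact: negligible_set0.
  by apply/negligibleP => //; exact: measurable_itv.
move=> x /= /existsNP[U /not_implyP[oU /not_implyP[Ux /negP]]].
rewrite -leNgt measure_le0 => /eqP U0.
have [e /= e0 eU] := (@nbhs_ballP _ _ _ _).1 (open_nbhs_nbhs (conj oU Ux)).
have [p] := rat_in_itvoo (x := x - e) (y := x) (ltac:(by rewrite ltrBlDr ltrDl)).
rewrite in_itv/= => /andP[xp px].
have [q] := rat_in_itvoo (x := x) (y := x + e) (ltac:(by rewrite ltrDl)).
rewrite in_itv/= => /andP[xq qx].
exists (pickle (p, q)); [exact: I|rewrite /F pickleK].
have IU (y : R) : J (p, q) y -> U y.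
  rewrite /J/= in_itv/= => /andP[py yq]; apply: eU; rewrite /ball/=.
  by rewrite ltr_norml; apply/andP; split; move: py yq xp qx; lra.
suff -> : mu (J (p, q)) = 0%E by rewrite eqxx /J/= in_itv/= px.
apply/eqP; rewrite -measure_le0 -U0; apply: le_measure => [||y /IU//]; rewrite inE.
  exact: measurable_itv.
exact: open_measurable.
Qed.

End support.

(** * Moment generating function of the translate by [c] *)

Section moments.
Context {R : realType}.
Variables (mu : probability (measurableTypeR R) R) (c s : R).

Let D : set (measurableTypeR R) := `[- c, s]%classic.

Hypothesis muDC : mu (~` D) = 0%E.
Hypothesis s_supp : msupport mu s.
Hypothesis cs : - c <= s.

Let mD : measurable D. Proof. exact: measurable_itv. Qed.

Let muD : mu D = 1%E.
Proof.
by rewrite -(setCK D) probability_setC ?muDC ?sube0//; exact: measurableC.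
Qed.

Lemma int_cst (r : R) : (\int[mu]_(x in D) cst r%:E x = r%:E)%E.
Proof. by rewrite integral_cst// [X in (_ * X)%E]muD mule1. Qed.

Let X_ge0 (x : R) : D x -> 0 <= x + c.
Proof. by rewrite /D/= in_itv/= => /andP[+ _]; rewrite -lerBlDr sub0r. Qed.

Let X_le (x : R) : D x -> x + c <= s + c.
Proof. by rewrite /D/= in_itv/= => /andP[_]; rewrite lerD2r. Qed.

Let sc0 : 0 <= s + c. Proof. by rewrite -lerBlDr sub0r. Qed.

Let mX (E : set (measurableTypeR R)) n : measurable_fun E (fun x : R => (x + c) ^+ n).
Proof. by apply: measurable_funX; apply: measurable_funD. Qed.

Definition moment n : R := fine (\int[mu]_(x in D) ((x + c) ^+ n)%:E).

Lemma moment_ge0 n : 0 <= moment n.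
Proof.
by apply/fine_ge0/integral_ge0 => x Dx; rewrite lee_fin exprn_ge0// X_ge0.
Qed.

Lemma momentE n : (moment n)%:E = (\int[mu]_(x in D) ((x + c) ^+ n)%:E)%E.
Proof.
rewrite fineK// ge0_fin_numE; last first.
  by apply: integral_ge0 => x Dx; rewrite lee_fin exprn_ge0// X_ge0.
apply: (@le_lt_trans _ _ (\int[mu]_(x in D) cst ((s + c) ^+ n)%:E x)%E).
  apply: ge0_le_integral => //.
  - by move=> x Dx; rewrite lee_fin exprn_ge0// X_ge0.
  - by apply/measurable_EFinP; exact: mX.
  - by move=> x Dx; rewrite lee_fin lerXn2r ?nnegrE ?(X_ge0 Dx) ?(X_le Dx).
by rewrite int_cst ltry.
Qed.

Lemma moment0 : moment 0 = 1.
Proof.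
have : (moment 0)%:E = 1%E.
  rewrite momentE; under eq_integral do rewrite expr0.
  exact: int_cst.
by case.
Qed.

(** Tonelli for nonnegative integrands; both sides may be infinite. *)
Lemma psum_momentE (v : R) : 0 <= v -> psum moment v =
  (\int[mu]_(x in D) \sum_(0 <= n <oo) ((v * (x + c)) ^+ n)%:E)%E.
Proof.
move=> v0; rewrite integral_nneseries//; last 2 first.
- move=> n; apply/measurable_EFinP; apply: measurable_funX.
  by apply: measurable_funM => //; apply: measurable_funD.
- by move=> n x Dx; rewrite lee_fin exprn_ge0// mulr_ge0// X_ge0.
apply: eq_eseriesr => n _; rewrite mulrC EFinM momentE -ge0_integralZl_EFin//.
- by apply: eq_integral => x _; rewrite exprMn EFinM.
- by move=> x Dx; rewrite lee_fin exprn_ge0// X_ge0.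
- by apply/measurable_EFinP; exact: mX.
- exact: exprn_ge0.
Qed.

Lemma psum_geometric (q : R) : 0 <= q -> q < 1 ->
  (\sum_(0 <= n <oo) (q ^+ n)%:E = ((1 - q)^-1)%:E)%E.
Proof.
move=> q0 q1; apply/cvg_lim => //.
have -> : (fun N => (\sum_(0 <= n < N) (q ^+ n)%:E)%E) =
    EFin \o series (geometric 1 q).
  apply/funext => N; rewrite /= sumEFin /series/=.
  by under [in RHS]eq_bigr do rewrite mul1r.
apply: cvg_EFin; first exact: nearW.
by rewrite -div1r; apply: cvg_geometric_series; rewrite ger0_norm.
Qed.

Let vX_lt1 (v x : R) : 0 <= v -> v * (s + c) < 1 -> D x ->
  0 <= v * (x + c) < 1.
Proof.
move=> v0 vsc Dx; rewrite mulr_ge0 ?X_ge0//=; apply: le_lt_trans vsc.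
by rewrite ler_wpM2l// X_le.
Qed.

Lemma psum_moment_resolvent (v : R) : 0 <= v -> v * (s + c) < 1 ->
  psum moment v = (\int[mu]_(x in D) ((1 - v * (x + c))^-1)%:E)%E.
Proof.
move=> v0 vsc; rewrite psum_momentE//; apply: eq_integral => x; rewrite inE => Dx.
by have /andP[? ?] := vX_lt1 v0 vsc Dx; rewrite psum_geometric.
Qed.

Let sum_ge0 (v : R) : 0 <= v -> forall x, D x ->
  (0 <= \sum_(0 <= n <oo) ((v * (x + c)) ^+ n)%:E)%E.
Proof.
move=> v0 x Dx; apply: nneseries_ge0 => n _ _.
by rewrite lee_fin exprn_ge0// mulr_ge0// X_ge0.
Qed.

Let mf (v : R) : 0 <= v -> measurable_fun D (fun x : measurableTypeR R =>
  (\sum_(0 <= n <oo) ((v * (x + c)) ^+ n)%:E)%E).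
Proof.
move=> v0; apply: ge0_emeasurable_sum => [n x Dx _|n _].
  by rewrite lee_fin exprn_ge0// mulr_ge0// X_ge0.
apply/measurable_EFinP; apply: measurable_funX.
by apply: measurable_funM => //; apply: measurable_funD.
Qed.

Lemma psum_moment_lty (v : R) : 0 <= v -> v * (s + c) < 1 ->
  (psum moment v < +oo)%E.
Proof.
move=> v0 vsc; rewrite psum_momentE//.
apply: (@le_lt_trans _ _ (\int[mu]_(x in D) cst ((1 - v * (s + c))^-1)%:E x)%E);
  last by rewrite int_cst ltry.
apply: ge0_le_integral => //.
- exact: sum_ge0.
- exact: mf.
move=> x Dx; have /andP[p q] := vX_lt1 v0 vsc Dx.
rewrite psum_geometric// lee_fin lef_pV2 ?posrE ?subr_gt0//.
by rewrite lerD2l lerN2 ler_wpM2l// X_le.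
Qed.

(** Otherwise v (x + c) > 1 on a neighbourhood of [s], which has positive mass because [s] is in the
    support, and the geometric series is infinite there. *)
Lemma psum_moment_radius (v : R) : 0 <= v -> (psum moment v < +oo)%E ->
  v * (s + c) <= 1.
Proof.
move=> v0 fin; rewrite leNgt; apply/negP => vsc.
pose U : set (measurableTypeR R) := [set x : R | 1 < v * (x + c)].
have oU : open (U : set R).
  rewrite (_ : U = (fun x : R => v * (x + c)) @^-1` `]1, +oo[%classic); last first.
    by apply/seteqP; split => x /=; rewrite in_itv/= andbT.
  apply: open_comp; last exact: interval_open.
  move=> x _; apply: cvgMr; apply: cvgD; [exact: cvg_id|exact: cvg_cst].
have U_gt0 : (0 < mu U)%E by exact: s_supp.
have mU : measurable U by exact: open_measurable.
(* The part of [U] outside [D] is null. *)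
have UD_gt0 : (0 < mu (U `&` D))%E.
  rewrite (lt_le_trans U_gt0)// -[leRHS]adde0 -muDC.
  apply: le_trans (measureU2 _ _ _); [|exact: measurableI|exact: measurableC].
  apply: le_measure; rewrite ?inE//.
    by apply: measurableU; [exact: measurableI|exact: measurableC].
  by move=> x Ux; have [Dx|] := pselect (D x); [left|right].
move: fin; rewrite ltNge => /negP[].
rewrite psum_momentE//.
apply: (@le_trans _ _ (\int[mu]_(x in U `&` D) cst +oo%E x)%E).
  by rewrite integral_cst ?gt0_mulye//; exact: measurableI.
apply: le_trans
  (ge0_subset_integral _ _ _ (mf v0) (sum_ge0 v0) (@subIsetr _ U D)) => //;
  last exact: measurableI.
rewrite le_eqVlt; apply/orP; left; apply/eqP; apply: eq_integral => x.
rewrite inE => -[/= Ux Dx]; apply/esym/eqyP => A A0.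
(* Every term is at least 1, so this many terms exceed [A]. *)
apply: (@le_trans _ _ (\sum_(0 <= n < Num.Def.archi_bound A) 1%:E)%E).
  rewrite sumEFin lee_fin big_const_nat subn0 iter_addr_0.
  by rewrite ltW// archi_boundP// ltW.
apply: le_trans (nneseries_lim_ge _ _) => [|n _ _].
  by apply: lee_sum => n _; rewrite lee_fin exprn_ege1// ltW.
by rewrite lee_fin exprn_ge0// mulr_ge0// X_ge0.
Qed.

End moments.

(** * The functional equation and the infimum formula *)

Section cauchy_transform_real.
Context {R : realType}.
Variables (mu : probability (measurableTypeR R) R) (c s : R).

Let D : set (measurableTypeR R) := `[- c, s]%classic.

Hypothesis muDC : mu (~` D) = 0%E.
Hypothesis cs : - c <= s.

Let mD : measurable D. Proof. exact: measurable_itv. Qed.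

Local Notation moment := (moment mu c s).

(** Continuity gives measurability off the pole; the singleton at the pole is treated apart. *)
Lemma measurable_resolvent (w : R) :
  measurable_fun setT (fun x : measurableTypeR R =>
    (w - x)^-1 : measurableTypeR R).
Proof.
pose W : set (measurableTypeR R) := [set w].
have mW : measurable W by exact: measurable_set1.
rewrite -(setvU W); apply/(measurable_funU _ (measurableC mW) mW).
split; last exact: measurable_fun_set1.
apply: open_continuous_measurable_fun.
  rewrite openC; apply: accessible_closed_set1; apply: hausdorff_accessible.
  exact: Rhausdorff.
move=> x; rewrite inE/= => /eqP xw; apply: (@continuousV R R (fun x => w - x) x).
  by rewrite subr_eq0 eq_sym.
by apply: cvgB; [exact: cvg_cst|exact: cvg_id].
Qed.

(** With v = 1 / (w + c), the resolvent 1 / (w - x) equals v / (1 - v (x + c)) on [D]; it is real,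
    and the complement of [D] is null. *)
Lemma cauchy_transform_real (w : R) : s < w ->
  cauchy_transform mu w%:C%C =
  ((w + c)^-1 * fine (psum moment (w + c)^-1))%:C%C.
Proof.
move=> sw.
have wc : 0 < w + c by rewrite -ltrBlDr sub0r (le_lt_trans cs).
have v0 : 0 <= (w + c)^-1 by rewrite invr_ge0 ltW.
have vsc : (w + c)^-1 * (s + c) < 1 by rewrite mulrC ltr_pdivrMr// mul1r ltrD2r.
have zE (t : R) : (w%:C%C - t%:C%C)^-1 = ((w - t)^-1)%:C%C :> R[i].
  by rewrite -rmorphB -fmorphV.
rewrite /cauchy_transform.
under eq_Rintegral do rewrite zE /=.
under [X in (_ +i* X)%C]eq_Rintegral do rewrite zE /=.
rewrite Rintegral_cst// mul0r.
rewrite /real_complex_def; congr (_ +i* _)%C.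
rewrite /Rintegral -(setUv D) integral_setU//; last 3 first.
- exact: measurableC.
- by rewrite setUv; apply/measurable_EFinP; exact: measurable_resolvent.
- by apply/disj_set2P; exact: setICr.
rewrite [X in (_ + X)%E](_ : _ = 0%E) ?adde0; last first.
  apply: null_set_integral => //; first exact: measurableC.
  by apply/measurable_EFinP; apply: measurable_funTS; exact: measurable_resolvent.
rewrite -[RHS]/(fine ((w + c)^-1)%:E * _) -fineM//; last first.
  by rewrite psum_fin_num// ?psum_moment_lty// => n; exact: moment_ge0.
rewrite psum_moment_resolvent// -ge0_integralZl_EFin//; last 2 first.
- move=> x; rewrite /D/= in_itv/= => /andP[_ xs].
  rewrite lee_fin invr_ge0 subr_ge0 mulrC ler_pdivrMr// mul1r lerD2r.
  by rewrite (le_trans xs)// ltW.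
- apply/measurable_EFinP; rewrite [X in measurable_fun _ X](_ : _ =
      (fun x : measurableTypeR R => (w + c) * (w - x)^-1)).
    apply: measurable_funM => //; apply: measurable_funTS.
    exact: measurable_resolvent.
  apply/funext => x; transitivity (((w + c)^-1 * (w - x))^-1).
    by congr (_^-1); field; rewrite gt_eqF.
  by rewrite invfM invrK.
congr fine; apply: eq_integral => x; rewrite inE /D/= in_itv/= => /andP[_ xs].
rewrite -EFinM -invfM; congr (_^-1)%:E.
by rewrite mulrBr mulr1 mulrA divff ?gt_eqF// mul1r; ring.
Qed.

End cauchy_transform_real.

Lemma cvg_real_complex {R : realType} (u : nat -> R) (l : R) :
  (fun n => (u n)%:C%C : R[i]^o) @ \oo --> (l%:C%C : R[i]^o) -> u @ \oo --> l.
Proof.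
move=> ul; apply/cvgrPdist_lt => e e0.
have e0' : (0 : R[i]) < e%:C%C by rewrite ltcR.
move/cvgrPdist_lt : ul => /(_ _ e0'); apply: filterS => n /=.
rewrite -rmorphB normc_def/= expr0n addr0 sqrtr_sqr.
by rewrite ltcR.
Qed.

(** * From free cumulants to the infimum formula and the Dirac case *)

Section cumulant_relation.
Context {R : realType}.
Variables (mu : probability (measurableTypeR R) R) (kappa : nat -> R) (c s : R).

Let D : set (measurableTypeR R) := `[- c, s]%classic.

Hypothesis muDC : mu (~` D) = 0%E.
Hypothesis s_supp : msupport mu s.
Hypothesis cs : - c <= s.
Hypothesis c0 : 0 <= c.
Hypothesis kappa_ge0 : forall n, (1 <= n)%N -> 0 <= kappa n.
Hypothesis kappa_cumulants : are_free_cumulants mu kappa.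

Let m := moment mu c s.
Let m0 n : 0 <= m n. Proof. exact: moment_ge0. Qed.

Let sc0 : 0 <= s + c. Proof. by rewrite -lerBlDr sub0r. Qed.

(* F(t) = t K(t), where K is the inverse of the Cauchy transform of the
   translate of mu by c. *)
Definition Fcoef n :=
  if n is n'.+1 then (if n' is 0 then c else 0) + kappa n else 1.

Let F0 n : 0 <= Fcoef n.
Proof. by case: n => [|[|n]] //=; rewrite ?add0r ?addr_ge0 ?kappa_ge0. Qed.

Lemma psum_Fcoef (t : R) : 0 <= t ->
  psum Fcoef t = (1 + t%:E * (c%:E + Rtrans kappa t))%E.
Proof.
move=> t0; rewrite (psum_recl F0 t0); congr (_ + _ * _)%E.
rewrite (psum_recl (fun n => F0 n.+1) t0)/=.
have k0 n : 0 <= kappa n.+1 by exact: kappa_ge0.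
have -> : Rtrans kappa t = psum (fun n => kappa n.+1) t by [].
rewrite (psum_recl k0 t0) EFinD -addeA; congr (_ + (_ + _ * _))%E.
by apply: eq_eseriesr => n _; rewrite add0r.
Qed.

Lemma psum_Fcoef_fin (t r : R) : 0 <= t -> Rtrans kappa t = r%:E ->
  psum Fcoef t = (1 + t * (c + r))%:E.
Proof. by move=> t0 rE; rewrite psum_Fcoef// rE. Qed.

Let mge1 (v : R) : 0 <= v -> (psum m v < +oo)%E -> 1 <= fine (psum m v).
Proof.
move=> v0 fin; rewrite -lee_fin fineK ?psum_fin_num//.
apply: le_trans (partial_le_psum 1 m0 v0).
by rewrite big_nat1 expr0 mulr1 /m moment0.
Qed.

(** At the real point w = 1 / v - c the Cauchy transform is y = v M(v), so K(y) = w, and R(y) = K(y)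
    - 1 / y. *)
Lemma Rtrans_small : exists d : R, [/\ 0 < d, d * (s + c) < 1
  & forall v : R, 0 < v -> v <= d ->
    Rtrans kappa (v * fine (psum m v)) =
    (v^-1 - c - (v * fine (psum m v))^-1)%:E].
Proof.
have [K [[M KG] _] [e e0 Ksum]] := kappa_cumulants.
(* For [v <= B^-1], the point 1 / v - c exceeds both [s] and the absolute value of [M]. *)
pose B := s + c + `|M| + c + 1.
have B0 : 0 < B by rewrite /B; have := normr_ge0 M; move: sc0 c0; lra.
have BM : `|M| < B - c by rewrite /B; move: sc0; lra.
have Bsc : s + c < B by rewrite /B; have := normr_ge0 M; move: c0; lra.
have d1sc : B^-1 * (s + c) < 1 by rewrite mulrC ltr_pdivrMr// mul1r.
have B0' : 0 <= B^-1 by rewrite invr_ge0 ltW.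
have finA := psum_moment_lty muDC cs B0' d1sc.
pose A := fine (psum m B^-1).
have A1 : 1 <= A by exact: mge1.
have A0 : 0 < A by exact: lt_le_trans A1.
(* The second bound keeps v M(v) <= [d * A] in the disc of radius [e]; the factor 2 makes this
   strict. *)
pose d := Num.min B^-1 (e / (2 * A)).
have d0 : 0 < d by rewrite lt_min invr_gt0 B0 divr_gt0// mulr_gt0.
have dB : d <= B^-1 by rewrite ge_min lexx.
exists d; split => //; first by apply: le_lt_trans d1sc; rewrite ler_wpM2r.
move=> v v0 vd.
have vB : v <= B^-1 by exact: le_trans dB.
have vsc : v * (s + c) < 1 by apply: le_lt_trans d1sc; rewrite ler_wpM2r.
have vfin := psum_moment_lty muDC cs (ltW v0) vsc.
set y := v * fine (psum m v).
have y0 : 0 < y by rewrite mulr_gt0// (lt_le_trans _ (mge1 (ltW v0) vfin)).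
have ye : y < e.
  have : y <= d * A.
    rewrite ler_pM ?(ltW v0)//; first exact/ltW/(lt_le_trans _ (mge1 (ltW v0) vfin)).
    by rewrite fine_le ?psum_fin_num ?psum_homo ?(ltW v0).
  move=> /le_lt_trans; apply; rewrite -ltr_pdivlMr// gt_min; apply/orP; right.
  by rewrite ltr_pM2l// ltf_pV2 ?posrE ?mulr_gt0// ltr_pMl// ltr1n.
pose w := v^-1 - c.
have Bv : B <= v^-1 by rewrite -(invrK B) lef_pV2 ?posrE ?invr_gt0.
have sw : s < w by rewrite /w ltrBrDr (lt_le_trans Bsc).
have Mw : `|M| < w by rewrite (lt_le_trans BM)// lerD2r.
have GE : cauchy_transform mu w%:C%C = y%:C%C.
  by rewrite (cauchy_transform_real muDC cs sw) /w subrK invrK.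
have KE : K y%:C%C = w%:C%C.
  rewrite -GE; apply: KG; rewrite normc_def/= expr0n addr0 sqrtr_sqr ltcR.
  by apply: (le_lt_trans (ler_norm M)); apply: (lt_le_trans Mw); exact: ler_norm.
have := Ksum y%:C%C; rewrite KE normc_def/= expr0n addr0 sqrtr_sqr gtr0_norm//.
rewrite !ltcR y0 ye => /(_ isT).
rewrite -fmorphV -rmorphB => cv.
have : series (fun n => kappa n.+1 * y ^+ n) @ \oo --> (w - y^-1).
  apply: cvg_real_complex; move: cv; apply: cvg_trans.
  apply: near_eq_cvg; apply: nearW => N; rewrite /series/= rmorph_sum.
  by apply: eq_bigr => n _; rewrite [RHS](rmorphM _ (kappa n.+1)) rmorphXn.
move=> cr; apply/cvg_lim => //.
have -> : (fun N => (\sum_(0 <= n < N) (kappa n.+1 * y ^+ n)%:E)%E) =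
    EFin \o series (fun n => kappa n.+1 * y ^+ n).
  by apply/funext => N; rewrite /= sumEFin.
by apply: cvg_EFin; first exact: nearW.
Qed.

Let mS0 := shiftX_ge0 m0.

(** For small v and y = v M(v), [Rtrans_small] gives F(y) = 1 + y (1 / v - 1 / y) = M(v); [psum_inj]
    passes to coefficients. *)
Lemma moment_fixpoint n : m n = pcomp Fcoef (shiftX m) n.
Proof.
have [d [d0 dsc H]] := Rtrans_small.
have fin (v : R) : 0 < v -> v <= d -> psum m v \is a fin_num.
  move=> v0 vd; have vsc : v * (s + c) < 1.
    by apply: le_lt_trans dsc; rewrite ler_wpM2r.
  exact: psum_fin_num m0 (ltW v0) (psum_moment_lty muDC cs (ltW v0) vsc).
have finlt (v : R) : 0 < v -> v <= d -> (psum m v < +oo)%E.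
  by move=> v0 vd; rewrite -ge0_fin_numE ?fin ?psum_ge0// ltW.
apply: (psum_inj m0 (pcomp_ge0 F0 mS0) d0); first exact: finlt.
move=> v v0 vd; set A := fine (psum m v).
have AE : psum m v = A%:E by rewrite fineK// fin.
have A0 : 0 < A by apply: lt_le_trans (mge1 (ltW v0) (finlt v v0 vd)).
have SE : psum (shiftX m) v = (v * A)%:E by rewrite psum_shiftX ?(ltW v0)// AE.
have y0 : 0 <= v * A by rewrite mulr_ge0 ?ltW.
rewrite (psum_pcomp F0 mS0 _ (ltW v0) SE)// (psum_Fcoef_fin y0 (H v v0 vd)) -/A AE.
congr EFin; field.
by rewrite !gt_eqF.
Qed.

(** For v = u / F(u), [psum_supersolution] makes M(v) finite, hence v (s + c) <= 1, that is, s + c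
    <= F(u) / u. *)
Lemma max_support_le (u r : R) : 0 < u -> Rtrans kappa u = r%:E -> s <= u^-1 + r.
Proof.
move=> u0 uE; have FE := psum_Fcoef_fin (ltW u0) uE.
set A := 1 + _ in FE.
have r0 : 0 <= r by rewrite -lee_fin -uE psum_ge0 ?ltW// => n; exact: kappa_ge0.
have A0 : 0 < A by rewrite /A ltr_wpDr// mulr_ge0 ?(ltW u0)// addr_ge0.
have v0 : 0 <= u / A by rewrite divr_ge0 ?ltW.
have := psum_supersolution F0 m0 moment_fixpoint v0 (ltW u0) FE.
rewrite divfK ?gt_eqF// lexx => /(_ isT) /le_lt_trans /(_ (ltry _)).
move=> /(psum_moment_radius muDC s_supp cs v0).
rewrite mulrAC ler_pdivrMr// mul1r -ler_pdivlMl// /A => H.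
rewrite -(lerD2r c); apply: (le_trans H); rewrite mulrDr mulr1 mulKf ?gt_eqF//.
by rewrite addrAC addrA.
Qed.

(** For v = 1 / (x + c), M(v) is finite; u = v M(v) then satisfies F(u) = M(v), so F(u) / u = x +
    c. *)
Lemma max_support_approx (x : R) : s < x -> exists u r : R,
  [/\ 0 < u, Rtrans kappa u = r%:E & u^-1 + r = x].
Proof.
move=> sx; have xc : 0 < x + c by rewrite (le_lt_trans sc0)// ltrD2r.
have v0 : 0 < (x + c)^-1 by rewrite invr_gt0.
have vsc : (x + c)^-1 * (s + c) < 1 by rewrite mulrC ltr_pdivrMr// mul1r ltrD2r.
have fin := psum_moment_lty muDC cs (ltW v0) vsc.
have := mge1 (ltW v0) fin.
have := fineK (psum_fin_num m0 (ltW v0) fin); set A := fine _ => /esym AE A1.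
have A0 : 0 < A by exact: lt_le_trans A1.
have u0 : 0 < (x + c)^-1 * A by exact: mulr_gt0.
have := psum_fixpoint F0 m0 moment_fixpoint (ltW v0) AE.
move=> FE.
have rfin : Rtrans kappa ((x + c)^-1 * A) \is a fin_num.
  rewrite ge0_fin_numE ?psum_ge0 ?(ltW u0)//; last by move=> n; exact: kappa_ge0.
  rewrite ltey; apply/eqP => E; move: FE.
  by rewrite psum_Fcoef ?(ltW u0)// E addey// gt0_muley ?lte_fin.
exists ((x + c)^-1 * A), (fine (Rtrans kappa ((x + c)^-1 * A))).
split => //; first by rewrite fineK.
move: FE; rewrite (psum_Fcoef_fin (ltW u0) (esym (fineK rfin))) => -[].
set r := fine _ => FE.
set u := (x + c)^-1 * A in u0 FE *.
have uE : u * (x + c) = A by rewrite /u mulrAC mulVf ?mul1r ?gt_eqF.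
apply: (mulfI (lt0r_neq0 u0)).
rewrite mulrDr mulfV ?gt_eqF//; move: FE uE; rewrite !mulrDr; lra.
Qed.

Lemma moment1 : m 1%N = kappa 1%N + c.
Proof.
rewrite moment_fixpoint /pcomp big_ord_recr big_ord1/= /conv.
rewrite !big_ord_recr big_ord0 /= !mulr0 /m (moment0 muDC cs); ring.
Qed.

(** Here R is the constant [kappa 1], the mean. Letting u grow in [max_support_le] bounds [s] by the
    mean, so the nonnegative function s - x has zero integral and x = s almost everywhere. *)
Lemma dirac_of_cumulants : (forall n, (2 <= n)%N -> kappa n = 0) -> is_dirac mu.
Proof.
move=> k0.
have RE (u : R) : 0 <= u -> Rtrans kappa u = (kappa 1%N)%:E.
  move=> u0; have k10 n : 0 <= kappa n.+1 by exact: kappa_ge0.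
  have -> : Rtrans kappa u = psum (fun n => kappa n.+1) u by [].
  rewrite psum_recl// (_ : psum _ u = 0%E) ?mule0 ?adde0//.
  by apply: eseries0 => n _ _; rewrite k0// mul0r.
have sk1 : s <= kappa 1%N.
  apply/ler_addgt0Pl => e e0; have := max_support_le (u := e^-1).
  by rewrite invr_gt0 invrK; apply => //; rewrite RE// invr_ge0 ltW.
have mDs (E : set (measurableTypeR R)) :
    measurable_fun E (fun x : measurableTypeR R => s - x).
  by apply: measurable_funB.
have mXc (E : set (measurableTypeR R)) :
    measurable_fun E (fun x : measurableTypeR R => x + c).
  by apply: measurable_funD.
have mD : measurable D by exact: measurable_itv.
have sD x : D x -> 0 <= s - x.
  by rewrite /D/= in_itv/= => /andP[_ ?]; rewrite subr_ge0.
have cD x : D x -> 0 <= x + c.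
  by rewrite /D/= in_itv/= => /andP[+ _]; rewrite -lerBlDr sub0r.
have I0 : (\int[mu]_(x in D) (s - x)%:E = 0)%E.
  have I1 : (\int[mu]_(x in D) (x + c)%:E = (kappa 1%N + c)%:E)%E.
    by rewrite -moment1 /m (momentE muDC cs).
  (* Adding x + c keeps both integrands nonnegative; the integral of s - x then comes out as
     [s - kappa 1], which is at most 0. *)
  have : (\int[mu]_(x in D) ((s - x)%:E + (x + c)%:E) = (s + c)%:E)%E.
    rewrite -(int_cst muDC (s + c)); apply: eq_integral => x _.
    by rewrite -EFinD /cst; congr EFin; ring.
  rewrite ge0_integralD//; last 2 first.
  - exact/measurable_EFinP.
  - exact/measurable_EFinP.
  rewrite I1; have : (0 <= \int[mu]_(x in D) (s - x)%:E)%E by exact: integral_ge0.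
  case: (\int[mu]_(x in D) (s - x)%:E)%E => [r|//|//].
  rewrite lee_fin -EFinD => r0 [rE]; congr EFin; apply/eqP.
  by rewrite eq_le r0 andbT; move: rE sk1; lra.
have msC : measurable (~` [set s] : set (measurableTypeR R)).
  by apply: measurableC; exact: measurable_set1.
have Ds : mu (~` [set s]) = 0%E.
  have IA : (\int[mu]_(x in D) `|(s - x)%:E| = 0)%E.
    rewrite -[RHS]I0; apply: eq_integral => x; rewrite inE => Dx.
    by rewrite gee0_abs// lee_fin sD.
  have [|N [mN N0 DN]] := (ae_eq_integral_abs mu mD _).1 IA.
    exact/measurable_EFinP.
  have mDC : measurable (~` D) by exact: measurableC.
  apply/eqP; rewrite -measure_le0.
  apply: (@le_trans _ _ (mu (~` D `|` N))).
    apply: le_measure; rewrite ?inE//; first exact: measurableU.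
    move=> x xs; have [Dx|] := pselect (D x); last by left.
    right; apply: DN => /= /(_ Dx) [] /eqP; rewrite subr_eq0 => /eqP sx.
    exact/xs/esym.
  by apply: le_trans (measureU2 _ mDC mN) _; rewrite [X in (X + _ <= _)%E]muDC
    [X in (_ + X <= _)%E]N0 adde0.
have null (B : set (measurableTypeR R)) : measurable B -> ~ B s -> mu B = 0%E.
  move=> mB Bs; apply/eqP; rewrite -measure_le0 -Ds.
  by apply: le_measure; rewrite ?inE// => x Bx /= xs; apply: Bs; rewrite -xs.
exists s => A mA; rewrite diracE; have [As|As] := boolP (s \in A).
  rewrite -(setCK A) probability_setC; last exact: measurableC.
  by rewrite null ?sube0//; [exact: measurableC|apply; rewrite -inE].
by rewrite null// => /mem_set; apply/negP.
Qed.

End cumulant_relation.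

(** * Reduction to an interval, and conclusion *)

Lemma msupport_itv (R : realType) (mu : probability (measurableTypeR R) R)
    (s : R) : compact (msupport mu) -> is_maximum (msupport mu) s ->
  exists c : R, [/\ 0 <= c, - c <= s & mu (~` `[- c, s]%classic) = 0%E].
Proof.
move=> /compact_bounded[M [Mreal HM]] [ss sub].
(* Boundedness only provides the estimate for constants strictly above [M]. *)
pose c := `|M| + 1.
have Mc : M < c by rewrite /c ltr_pwDr// ler_norm.
have c_ge (x : R) : msupport mu x -> - c <= x.
  by move=> /(HM _ Mc) /=; rewrite ler_norml => /andP[].
exists c; split; [by rewrite addr_ge0|exact: c_ge|].
apply: measure_negligible; first by apply: measurableC; exact: measurable_itv.
apply: negligibleS (negligible_compl_msupport mu) => x /= xD xs; apply: xD.
by rewrite in_itv/= c_ge//=; exact: sub.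
Qed.

Theorem theorem2 (R : realType) (mu : probability (measurableTypeR R) R)
    (kappa : nat -> R) (s : R)
    (mu_compact : compact (msupport mu))
    (mu_not_dirac : ~ is_dirac mu)
    (kappa_cumulants : are_free_cumulants mu kappa)
    (kappa_ge0 : forall n : nat, (1 <= n)%N -> 0 <= kappa n)
    (s_max : is_maximum (msupport mu) s) :
  ((1 <= nu kappa)%E ->
    exists xi : R,
      unique (fun x : R => [/\ 0 < x, (x%:E <= conv_radius kappa)%E
                             & Rtrans' kappa x = (1 / x ^+ 2)%:E]) xi /\
      s%:E = ((1 / xi)%:E + Rtrans kappa xi)%E) /\
  ((nu kappa < 1)%E ->
    exists2 rho : R, conv_radius kappa = rho%:E &
      s%:E = ((1 / rho)%:E + Rtrans kappa rho)%E).
Proof.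
have [c [c0 cs muDC]] := msupport_itv mu_compact s_max.
have s_supp : msupport mu s by case: s_max.
have s_le := max_support_le muDC s_supp cs c0 kappa_ge0 kappa_cumulants.
have s_apx := max_support_approx muDC cs c0 kappa_ge0 kappa_cumulants.
have kappa_gt0 : exists2 k, (2 <= k)%N & 0 < kappa k.
  apply: contrapT => H; apply: mu_not_dirac.
  apply: (dirac_of_cumulants muDC s_supp cs c0 kappa_ge0 kappa_cumulants) => n n2.
  apply/eqP; rewrite eq_le kappa_ge0 ?andbT ?(ltnW n2)// leNgt.
  by apply/negP => kn; apply: H; exists n.
(* Each alternative settles one case of the formula and contradicts the condition on [nu] in the
   other. *)
have [[xi cxi]|[x [d [x0 xr dE dx]]]] :=
    critical_or_radius kappa_ge0 kappa_gt0 s_apx; split => nu1.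
- exists xi; split; last exact: (critical_min kappa_ge0 s_le s_apx cxi).
  by split => // y; exact: (critical_inj kappa_ge0 cxi).
- by move: nu1; rewrite ltNge (critical_nu kappa_ge0 cxi).
- by move: nu1; rewrite leNgt (radius_nu kappa_ge0 x0 xr dE dx).
- exists x => //; exact: (radius_min kappa_ge0 s_le s_apx x0 xr dE (ltW dx)).
Qed.
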